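(* If $A$ is bounded, then $\|(Q_n-E)u\|\to 0$ as $n\to\infty$ for all $u\in\mathcal{H}$.
   Context: $\mathcal{H}$ is a Hilbert space with inner product $\langle\cdot,\cdot\rangle$ and norm $\|\cdot\|$. $A$ is a bounded self-adjoint operator on $\mathcal{H}$; $\mathfrak{a}$ is its quadratic form $\mathfrak{a}[u,v]=\langle Au,v\rangle$, with $\mathrm{Dom}(\mathfrak{a})=\mathcal{H}$, and $m:=\min\sigma(A)$. $\mathcal{H}_{\mathfrak{a}}$ is the Hilbert space $\mathrm{Dom}(\mathfrak{a})$ with inner product $\langle u,v\rangle_{\mathfrak{a}}:=\mathfrak{a}[u,v]-(m-1)\langle u,v\rangle$ and norm $\|u\|_{\mathfrak{a}}=\|(A-m+1)^{1/2}u\|$. $a<b$ are real numbers in the resolvent set $\rho(A)$, $\Delta=[a,b]$, and $\sigma_{\mathrm{ess}}(A)\cap\Delta=\varnothing$. $\mathcal{L}(\Delta)$ is the (finite-dimensional) spectral subspace of $A$ associated to $\sigma(A)\cap\Delta$, and $E$ is the orthogonal projection of $\mathcal{H}$ onto $\mathcal{L}(\Delta)$; $\mathrm{Rank}(E)=d<\infty$. $(\mathcal{L}_n)$ is a sequence of finite-dimensional subspaces of $\mathcal{H}_{\mathfrak{a}}$ such that for every $u\in\mathrm{Dom}(\mathfrak{a})$ there are $u_n\in\mathcal{L}_n$ with $\|u-u_n\|_{\mathfrak{a}}\to 0$. $A_n$ is the self-adjoint operator on $\mathcal{L}_n$ with $\langle A_nu,v\rangle=\mathfrak{a}[u,v]$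 for all $u,v\in\mathcal{L}_n$. $\mathcal{L}_n(\Delta)\subset\mathcal{L}_n$ is the span of the eigenvectors of $A_n$ with eigenvalues in $\Delta$, and $Q_n$ is the orthogonal projection of $\mathcal{H}$ onto $\mathcal{L}_n(\Delta)$. *)

(* Defs.v *)
From HB Require Import structures.
From mathcomp Require Import all_boot all_order all_algebra sesquilinear.
From mathcomp Require Import all_classical all_reals all_analysis.
From mathcomp.real_closed Require Import complex.

Set Implicit Arguments.
Unset Strict Implicit.
Unset Printing Implicit Defensive.

Import Order.TTheory GRing.Theory Num.Theory.
Import numFieldNormedType.Exports.

Local Open Scope classical_set_scope.
Local Open Scope ring_scope.
Local Open Scope complex_scope.

Section Operators.
Context {R : realType} {H : completeNormedModType R[i]}.
Implicit Types (ip : {dot H for (@Num.conj R[i])}) (A B E : H -> H) (M X : set H).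

(* With this, the complete normed space H is a complex Hilbert space; ip is
   linear in its first argument and conjugate-linear in its second. *)
Definition hilbert_norm ip := forall u : H, `|u| ^+ 2 = ip u u.

Definition bounded_operator A :=
  exists c : R[i], forall u : H, `|A u| <= c * `|u|.

Definition self_adjoint ip A := forall u v : H, ip (A u) v = ip u (A v).

Definition resolvent_set A : set R[i] :=
  [set z | exists B, [/\ bounded_operator B,
     cancel (fun u => A u - z *: u) B & cancel B (fun u => A u - z *: u)]].

Definition spectrum A : set R[i] := ~` resolvent_set A.

Definition lin_span X : set H :=
  [set u | exists k (c : 'I_k -> R[i]) (x : 'I_k -> H),
     (forall i, X (x i)) /\ u = \sum_i c i *: x i].

Definition has_dim M (d : nat) := exists e : 'I_d -> H,
  (forall c : 'I_d -> R[i], \sum_i c i *: e i = 0 -> forall i, c i = 0) /\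
  M = lin_span (range e).

Definition finite_dim M := exists d, has_dim M d.

Definition op_eigenspace A (z : R[i]) : set H := [set u | A u = z *: u].

Definition discrete_spectrum A : set R[i] :=
  [set z | [/\ isolated (spectrum A : set R[i]^o) z,
               op_eigenspace A z <> [set 0] & finite_dim (op_eigenspace A z)]].

Definition essential_spectrum A : set R[i] :=
  spectrum A `\` discrete_spectrum A.

Definition real_spectrum A : set R := [set x | spectrum A x%:C].

(* The relation m <= z in R[i] means that z is real and m <= z. *)
Definition is_min_spectrum A (m : R) :=
  spectrum A m%:C /\ forall z, spectrum A z -> m%:C <= z.

Definition sesqui_form ip A (u v : H) : R[i] := ip (A u) v.

Definition form_ip ip A (m : R) (u v : H) : R[i] :=
  sesqui_form ip A u v - (m - 1)%:C * ip u v.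

Definition form_norm ip A (m : R) (u : H) : R[i] := sqrtC (form_ip ip A m u u).

Definition orthogonal_projection ip M E :=
  forall u, M (E u) /\ forall v, M v -> ip (u - E u) v = 0.

(* Projection-valued Borel measure P on the real line with A = \int x dP(x),
   i.e. <A u, u> is the integral of x against the measure <P(.) u, u>.
   The values of P on non-measurable sets are irrelevant. *)
Record spectral_measure ip A (P : set (measurableTypeR R) -> H -> H) : Prop := {
  spectral_measure_proj : forall S, measurable S ->
    orthogonal_projection ip (range (P S)) (P S);
  spectral_measureT : forall u, P setT u = u;
  spectral_measureI : forall S T, measurable S -> measurable T ->
    forall u, P (S `&` T) u = P S (P T u);
  spectral_measure_sigma : forall F : nat -> set (measurableTypeR R),
    (forall n, measurable (F n)) -> trivIset setT F ->
    forall u, (fun n => \sum_(i < n) P (F i) u) @ \oo --> P (\bigcup_n F n) u;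
  spectral_measure_integral : forall u,
    exists mu : {measure set (measurableTypeR R) -> \bar R},
    [/\ forall S, measurable S -> mu S = (complex.Re (ip (P S u) u))%:E,
        mu.-integrable setT (EFin : measurableTypeR R -> \bar R) &
        ip (A u) u = (\int[mu]_x x)%R%:C] }.

(* The range of P D, where P is the spectral measure of A (which is unique). *)
Definition spectral_subspace ip A (D : set R) : set H :=
  [set u | exists2 P, spectral_measure ip A P & range (P D) u].

(* An is only constrained on the subspace M. *)
Definition galerkin_operator ip A M (An : H -> H) :=
  forall u, M u -> M (An u) /\ forall v, M v -> ip (An u) v = sesqui_form ip A u v.

Definition galerkin_subspace M (An : H -> H) (D : set R) : set H :=
  lin_span [set v | [/\ M v, v != 0 & exists2 x, D x & An v = x%:C *: v]].

End Operators.

(* Main.v *)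
Require Import Defs.
From HB Require Import structures.
From mathcomp Require Import all_boot all_order all_algebra sesquilinear.
From mathcomp Require Import all_classical all_reals all_analysis.
From mathcomp.real_closed Require Import complex.
From mathcomp Require Import ring lra.

(** Write [c] for the midpoint and [r] for the half-length of [[a, b]]. Membership
    in the range or in the kernel of a spectral projection is expressed by growth
    rates of powers of polynomials in the operator, which pass from [An] to [A].

    - As [a] and [b] are in the resolvent set, the spectral measure [P] of [A]
      does not charge the [e]-neighbourhoods of [a] and [b] for some [e > 0], nor
      any other measurable set of regular points ([resolvent_uncharged],
      [null_part_uncharged]). Hence [|(A - c)^k u| <= (r - e)^k |u|] on the range
      of the spectral projection ([iter_shifted_le]). On its kernel [A - c] is
      bounded below by [r + e], so [|(K - (A - c)^2)^k u| <= (K - (r + e)^2)^k |u|]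
      for [K] large enough ([iter_capped_le]).

    - Every vector of [L n] is a finite sum of orthogonal eigenvectors of [An]
      ([exists_eigen_sum]). Therefore [An - c] expands by at least [r] on the
      orthogonal complement of [L_n(Delta)] in [L n], and [K - (An - c)^2] by at
      least [K - r^2] on [L_n(Delta)] ([eigen_sum_lower_bound]).

    - If [x n] in [L n] tends to [u], then [An x n] tends to [A u] because [An x n]
      is the best approximation of [A x n] in [L n] ([galerkin_cvg_op]); so the
      same holds for polynomials in [An] and [A].

    Let [x n] in [L n] tend to [u]. For [u] in the range of the spectral
    projection, the component [z n] of [x n] orthogonal to [L_n(Delta)] satisfies
    [r^k |z n| <= |(An - c)^k (x n)|], whose limit in [n] is at most
    [(r - e)^k |u|]; large [k] forces [z n -> 0], that is [Q n u -> u]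
    ([geometric_squeeze], [projection_cvg_inner]). For [u] in the kernel the same
    argument with [K - (An - c)^2] gives [Q n u -> 0] ([projection_cvg_outer]).
    The theorem follows by splitting [u = E u + (u - E u)]. The absence of
    essential spectrum makes [sigma(A)] discrete in [[a, b]], hence the set that
    defines [E] is measurable. *)

Import Order.TTheory GRing.Theory Num.Theory.
Import numFieldNormedType.Exports.

Local Open Scope classical_set_scope.
Local Open Scope ring_scope.
Local Open Scope complex_scope.

(** * The underlying real inner product *)

Section RealInnerProduct.
Context {R : realType} {H : completeNormedModType R[i]}.
Context (ip : {dot H for (@Num.conj R[i])}).
Implicit Types u v w : H.

(** All the estimates compare real numbers, so they are made in the real
    Hilbert space underlying [H]: on a complex subspace, orthogonality for [ip]
    and for its real part agree. *)
Definition rip u v : R := complex.Re (ip u v).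

Definition nr u : R := Num.sqrt (rip u u).

Lemma ipC u v : ip u v = (ip v u)^*%C.
Proof. by rewrite (hermC ip u v) expr0 mul1r. Qed.

Lemma ripC u v : rip u v = rip v u.
Proof. by rewrite /rip ipC; case: (ip v u). Qed.

Lemma ripDl u v w : rip (u + v) w = rip u w + rip v w.
Proof. by rewrite /rip linearDl raddfD. Qed.

Lemma ripNl u w : rip (- u) w = - rip u w.
Proof. by rewrite /rip linearNl raddfN. Qed.

Lemma ripBl u v w : rip (u - v) w = rip u w - rip v w.
Proof. by rewrite ripDl ripNl. Qed.

Lemma ripZl (x : R) u v : rip (x%:C *: u) v = x * rip u v.
Proof.
by rewrite /rip linearZl_LR /=; case: (ip u v) => p q /=; rewrite mul0r subr0.
Qed.

Lemma rip0l v : rip 0 v = 0.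
Proof. by rewrite /rip linear0l raddf0. Qed.

Lemma ripDr u v w : rip w (u + v) = rip w u + rip w v.
Proof. by rewrite ripC ripDl !(ripC w). Qed.

Lemma ripNr u w : rip w (- u) = - rip w u.
Proof. by rewrite ripC ripNl (ripC w). Qed.

Lemma ripZr (x : R) u v : rip v (x%:C *: u) = x * rip v u.
Proof. by rewrite ripC ripZl (ripC v). Qed.

Lemma rip0r v : rip v 0 = 0.
Proof. by rewrite ripC rip0l. Qed.

Definition ripE := (ripDl, ripDr, ripNl, ripNr, ripZl, ripZr, rip0l, rip0r).

Lemma rip_suml (I : finType) (x : I -> H) v :
  rip (\sum_i x i) v = \sum_i rip (x i) v.
Proof.
by elim/big_rec2: _ => [|i p q _ <-]; rewrite ?rip0l // ripDl.
Qed.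

Lemma ip_self u : ip u u = (rip u u)%:C.
Proof.
have := ipC u u; rewrite /rip; case: (ip u u) => p q [] q0 /=.
by congr (_ +i* _); lra.
Qed.

Lemma rip_ge0 u : 0 <= rip u u.
Proof. by rewrite -ler0c -ip_self; exact: dnorm_ge0. Qed.

Lemma rip_eq0 u : rip u u = 0 -> u = 0.
Proof.
by move=> u0; apply/eqP; rewrite -(dnorm_eq0 ip) ip_self u0.
Qed.

Lemma nr_ge0 u : 0 <= nr u. Proof. exact: sqrtr_ge0. Qed.

Lemma nr_sqr u : nr u ^+ 2 = rip u u.
Proof. by rewrite sqr_sqrtr // rip_ge0. Qed.

Lemma nr_eq0 u : nr u = 0 -> u = 0.
Proof. by move=> u0; apply: rip_eq0; rewrite -nr_sqr u0 expr0n. Qed.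

Lemma nr0 : nr 0 = 0.
Proof. by rewrite /nr rip0l sqrtr0. Qed.

Lemma nrN u : nr (- u) = nr u.
Proof. by rewrite /nr !ripE opprK. Qed.

Lemma nrZ (x : R) u : nr (x%:C *: u) = `|x| * nr u.
Proof.
by rewrite /nr !ripE mulrA -expr2 sqrtrM ?sqr_ge0 // sqrtr_sqr.
Qed.

Lemma rip_le_nr u v : rip u v <= nr u * nr v.
Proof.
have [v0|vn0] := eqVneq (nr v) 0.
  by rewrite v0 mulr0 (nr_eq0 _ v0) rip0r.
have vp : 0 < nr v by rewrite lt_def vn0 nr_ge0.
have [u0|un0] := eqVneq (nr u) 0.
  by rewrite u0 mul0r (nr_eq0 _ u0) rip0l.
have up : 0 < nr u by rewrite lt_def un0 nr_ge0.
have := rip_ge0 ((nr v)%:C *: u - (nr u)%:C *: v).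
rewrite !ripE -!nr_sqr (ripC v u) => h.
have p : 0 < nr u * nr v by exact: mulr_gt0.
rewrite -(ler_pM2l p); nra.
Qed.

Lemma nrD u v : nr (u + v) <= nr u + nr v.
Proof.
have := rip_le_nr u v; have := nr_ge0 u; have := nr_ge0 v => pv pu h.
rewrite -(ler_pXn2r (n := 2)) ?nnegrE ?nr_ge0 ?addr_ge0 //.
rewrite nr_sqr !ripE (ripC v u) -!nr_sqr; nra.
Qed.

Lemma nrB u v : nr (u - v) <= nr u + nr v.
Proof. by rewrite (le_trans (nrD _ _)) // nrN. Qed.

Lemma nr_sqr_le u (s : R) : 0 <= s -> rip u u <= s ^+ 2 -> nr u <= s.
Proof.
by move=> s0 h; rewrite -(ler_pXn2r (n := 2)) ?nnegrE ?nr_ge0 // nr_sqr.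
Qed.

Lemma nr_pythagoras u v : rip u v = 0 -> nr (u + v) ^+ 2 = nr u ^+ 2 + nr v ^+ 2.
Proof. by move=> h; rewrite !nr_sqr !ripE (ripC v u) h; ring. Qed.

Lemma nr_orthogonal_sum N (x : 'I_N -> H) (l : 'I_N -> R) :
  (forall i j, i != j -> rip (x i) (x j) = 0) ->
  nr (\sum_i (l i)%:C *: x i) ^+ 2 = \sum_i l i ^+ 2 * nr (x i) ^+ 2.
Proof.
move=> ox; rewrite nr_sqr rip_suml; apply: eq_bigr => i _.
rewrite ripZl ripC rip_suml (bigD1 i) //= big1 => [|j ji].
  by rewrite nr_sqr !ripE; ring.
by rewrite ripZl ox // mulr0.
Qed.

Lemma rip_of_ip0 u v : ip u v = 0 -> rip u v = 0.
Proof. by rewrite /rip => ->. Qed.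

Hypothesis Hip : hilbert_norm ip.

Lemma normE u : `|u| = (nr u)%:C.
Proof.
apply/eqP; rewrite -(@eqrXn2 _ 2) ?normr_ge0 ?ler0c ?nr_ge0 //.
by rewrite Hip ip_self -nr_sqr rmorphXn.
Qed.

End RealInnerProduct.

(** * Symmetric operators on a subspace *)

Section Subspaces.
Context {R : realType} {H : completeNormedModType R[i]}.
Context (ip : {dot H for (@Num.conj R[i])}).
Implicit Types (u v w : H) (V X : set H) (T : H -> H).

Definition subspace V := V 0 /\ forall (c : R[i]) u v, V u -> V v -> V (c *: u + v).

Lemma subspaceD {V u v} : subspace V -> V u -> V v -> V (u + v).
Proof. by move=> [_ h] Vu Vv; have := h 1 _ _ Vu Vv; rewrite scale1r. Qed.

Lemma subspaceZ {V u} (c : R[i]) : subspace V -> V u -> V (c *: u).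
Proof. by move=> [V0 h] Vu; have := h c _ _ Vu V0; rewrite addr0. Qed.

Lemma subspaceB {V u v} : subspace V -> V u -> V v -> V (u - v).
Proof.
by move=> sV Vu Vv; rewrite -scaleN1r; apply: subspaceD => //; exact: subspaceZ.
Qed.

Lemma subspace_sum {V} (I : finType) (x : I -> H) :
  subspace V -> (forall i, V (x i)) -> V (\sum_i x i).
Proof.
move=> sV Vx; elim/big_rec: _ => [|i u _]; first by case: sV.
exact: subspaceD.
Qed.

Lemma conj_real (c : R) : Num.conj (c%:C : R[i]) = c%:C.
Proof. exact: conjc_real. Qed.

Lemma lin_span_subspace X : subspace (lin_span X).
Proof.
split=> [|c u v [k [p [x [Xx ->]]]] [k' [p' [x' [Xx' ->]]]]].
  exists 0%N, (fun=> 0), (fun=> 0).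
  by split; [case | rewrite big_ord0].
pose sel U (f : 'I_k -> U) (g : 'I_k' -> U) (i : 'I_(k + k')) :=
  match fintype.split i with inl j => f j | inr j => g j end.
exists (k + k')%N, (sel _ (fun i => c * p i) p'), (sel _ x x'); split.
  by move=> i; rewrite /sel; case: (fintype.split i).
rewrite big_split_ord scaler_sumr; congr (_ + _); apply: eq_bigr => i _ /=.
  by rewrite /sel (unsplitK (inl _ i)) scalerA.
by rewrite /sel (unsplitK (inr _ i)).
Qed.

Lemma lin_span_sub X V : subspace V -> X `<=` V -> lin_span X `<=` V.
Proof.
move=> sV XV u [k [p [x [Xx ->]]]]; apply: subspace_sum => // i.
exact/subspaceZ/XV/Xx.
Qed.

Lemma sub_lin_span X : X `<=` lin_span X.
Proof.
move=> u Xu; exists 1%N, (fun=> 1), (fun=> u); split=> //.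
by rewrite big_ord1 scale1r.
Qed.

Lemma ortho_subspace v : subspace [set u | ip u v = 0].
Proof.
split=> [|c u w /= u0 w0]; first by rewrite /= linear0l.
by rewrite linearPl /= u0 w0 mulr0 addr0.
Qed.

(** The operators of the Galerkin method are only constrained on a subspace,
    hence linearity and symmetry are relative to it. *)
Record symmetric_on V T : Prop := {
  symmetric_stable : forall u, V u -> V (T u);
  symmetric_linear : forall (c : R[i]) u v,
    V u -> V v -> T (c *: u + v) = c *: T u + T v;
  symmetric_ip : forall u v, V u -> V v -> ip (T u) v = ip u (T v) }.

Section SymmetricOn.
Variables (V : set H) (T : H -> H).
Hypotheses (sV : subspace V) (sT : symmetric_on V T).

Lemma symmetricD u v : V u -> V v -> T (u + v) = T u + T v.
Proof.
by move=> Vu Vv; have := symmetric_linear _ _ sT 1 _ _ Vu Vv; rewrite !scale1r.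
Qed.

Lemma symmetric0 : T 0 = 0.
Proof.
case: (sV) => V0 _; have := symmetricD _ _ V0 V0; rewrite addr0 => h.
by apply: (addrI (T 0)); rewrite -h addr0.
Qed.

Lemma symmetricZ (c : R[i]) u : V u -> T (c *: u) = c *: T u.
Proof.
move=> Vu; have [V0 _] := sV.
by have := symmetric_linear _ _ sT c _ _ Vu V0; rewrite symmetric0 !addr0.
Qed.

Lemma symmetricB u v : V u -> V v -> T (u - v) = T u - T v.
Proof.
move=> Vu Vv; rewrite -scaleN1r symmetricD ?symmetricZ ?scaleN1r //.
by rewrite -scaleN1r; exact: subspaceZ.
Qed.

Lemma symmetric_sum (I : finType) (x : I -> H) :
  (forall i, V (x i)) -> T (\sum_i x i) = \sum_i T (x i).
Proof.
move=> Vx.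
suff [] : V (\sum_i x i) /\ T (\sum_i x i) = \sum_i T (x i) by [].
elim/big_rec2: _ => [|i u v _ [Vv <-]].
  by split; [case: (sV) | exact: symmetric0].
by split; [exact: subspaceD | rewrite symmetricD].
Qed.

Lemma symmetric_rip u v : V u -> V v -> rip ip (T u) v = rip ip u (T v).
Proof. by move=> Vu Vv; rewrite /rip (symmetric_ip _ _ sT). Qed.

Lemma iter_stable k u : V u -> V (iter k T u).
Proof. by move=> Vu; elim: k => //= k; exact: (symmetric_stable _ _ sT). Qed.

Lemma iter_symmetric_rip k u v :
  V u -> V v -> rip ip (iter k T u) v = rip ip u (iter k T v).
Proof.
move=> Vu Vv; elim: k u Vu => // k IH u Vu.
rewrite iterSr IH; last exact: (symmetric_stable _ _ sT).
by rewrite symmetric_rip //; exact: iter_stable.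
Qed.

Lemma iter_symmetric_linear k (c : R[i]) u v : V u -> V v ->
  iter k T (c *: u + v) = c *: iter k T u + iter k T v.
Proof.
move=> Vu Vv; elim: k => //= k ->.
by rewrite (symmetric_linear _ _ sT) //; exact: iter_stable.
Qed.

Lemma symmetric_shift (c : R) : symmetric_on V (fun u => T u - c%:C *: u).
Proof.
split=> [u Vu|z u v Vu Vv|u v Vu Vv].
- by apply: subspaceB => //; [exact: (symmetric_stable _ _ sT) | exact: subspaceZ].
- rewrite (symmetric_linear _ _ sT) // scalerDr scalerBr !scalerA opprD.
  by rewrite addrACA [c%:C * z]mulrC.
- rewrite linearBl linearBr /= (symmetric_ip _ _ sT) // linearZl_LR linearZr_LR /=.
  by rewrite conj_real.
Qed.

Lemma symmetric_csub_sqr (c : R) : symmetric_on V (fun u => c%:C *: u - T (T u)).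
Proof.
have VT u : V u -> V (T u) by exact: (symmetric_stable _ _ sT).
split=> [u Vu|z u v Vu Vv|u v Vu Vv].
- by apply: subspaceB => //; [exact: subspaceZ | exact/VT/VT].
- rewrite !(symmetric_linear _ _ sT) //; try exact: VT.
  by rewrite scalerDr scalerBr !scalerA opprD addrACA [c%:C * z]mulrC.
- rewrite linearBl linearBr /= linearZl_LR linearZr_LR /=.
  rewrite !(symmetric_ip _ _ sT) //; try exact: VT.
  by rewrite conj_real.
Qed.

(** The quadratic form of a symmetric operator controls its norm: if
    [-s <= T <= s] as forms, then
    [2 s (s^2 - T^2) = (s + T) (s - T) (s + T) + (s - T) (s + T) (s - T)]
    is a sum of two nonnegative forms. *)
Lemma nr_le_form (s : R) : 0 < s ->
  (forall u, V u -> `|rip ip (T u) u| <= s * nr ip u ^+ 2) ->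
  forall u, V u -> nr ip (T u) <= s * nr ip u.
Proof.
move=> s0 fT u Vu.
have VT v : V v -> V (T v) by exact: (symmetric_stable _ _ sT).
have VTu := VT _ Vu; have VTTu := VT _ VTu.
have Vsu : V (s%:C *: u) by exact: subspaceZ.
have Vp : V (s%:C *: u + T u) by exact: subspaceD.
have Vm : V (s%:C *: u - T u) by exact: subspaceB.
have Tp : T (s%:C *: u + T u) = s%:C *: T u + T (T u).
  by rewrite symmetricD // symmetricZ.
have Tm : T (s%:C *: u - T u) = s%:C *: T u - T (T u).
  by rewrite symmetricB // symmetricZ.
have e1 : rip ip (T (T u)) u = rip ip (T u) (T u) by rewrite symmetric_rip.
have e2 : rip ip u (T u) = rip ip (T u) u by rewrite ripC.
have := fT _ Vp; have := fT _ Vm; rewrite !ler_norml Tp Tm !nr_sqr !ripE.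
rewrite e1 e2 => /andP[h1 h2] /andP[h3 h4].
apply: nr_sqr_le; first by rewrite mulr_ge0 ?nr_ge0 // ltW.
rewrite exprMn nr_sqr -(ler_pM2l s0).
move: h1 h2 h3 h4; move: (rip ip _ _) (rip ip _ _) (rip ip _ _) (rip ip _ _).
by move=> x y z t h1 h2 h3 h4; lra.
Qed.

Lemma nr_iter_le (s : R) : 0 <= s ->
  (forall u, V u -> nr ip (T u) <= s * nr ip u) ->
  forall k u, V u -> nr ip (iter k T u) <= s ^+ k * nr ip u.
Proof.
move=> s0 h k u Vu; elim: k => [|k IH] /=; first by rewrite expr0 mul1r.
apply: (le_trans (h _ (iter_stable k _ Vu))).
by rewrite exprS -mulrA ler_wpM2l.
Qed.

End SymmetricOn.
End Subspaces.

(** * Eigenvector decomposition in finite dimension *)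

Section EigenDecomposition.
Context {R : realType} {H : completeNormedModType R[i]}.
Context (ip : {dot H for (@Num.conj R[i])}).
Implicit Types (u v w : H) (V : set H) (T : H -> H).

(** [p(T) w], written on the orbit of [w] because [T] is linear only on a
    subspace. *)
Definition poly_act T (p : {poly R[i]}) w := \sum_(i < size p) p`_i *: iter i T w.

Lemma poly_act_widen T (p : {poly R[i]}) w n : (size p <= n)%N ->
  poly_act T p w = \sum_(i < n) p`_i *: iter i T w.
Proof.
move=> le; rewrite /poly_act (big_ord_widen _ (fun i => p`_i *: iter i T w) le).
rewrite big_mkcond; apply: eq_bigr => i _; case: ltnP => // h.
by rewrite nth_default // scale0r.
Qed.

Lemma poly_actMXsubC V T (q : {poly R[i]}) (z : R[i]) w :
  subspace V -> symmetric_on ip V T -> V w ->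
  poly_act T (q * ('X - z%:P)) w = poly_act T q (T w - z *: w).
Proof.
move=> sV sT Vw.
have VTw : V (T w) by exact: (symmetric_stable _ _ _ sT).
have itE i : iter i T (T w - z *: w) = iter i.+1 T w - z *: iter i T w.
  rewrite addrC -scaleNr (iter_symmetric_linear ip V T sT) // -iterSr.
  by rewrite scaleNr addrC.
have le : (size (q * ('X - z%:P))%R <= (size q).+1)%N.
  apply: leq_trans (size_polyMleq _ _) _.
  by rewrite size_XsubC addn2.
rewrite (poly_act_widen _ _ _ _ le).
transitivity (\sum_(i < (size q).+1) (q * 'X)`_i *: iter i T w -
              \sum_(i < (size q).+1) (z * q`_i) *: iter i T w).
  rewrite -sumrB; apply: eq_bigr => i _.
  by rewrite mulrBr coefB coefMC [z * _]mulrC scalerBl.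
rewrite big_ord_recl coefMX eqxx scale0r add0r.
rewrite [X in _ - X]big_ord_recr /= nth_default // mulr0 scale0r addr0.
rewrite -sumrB; apply: eq_bigr => i _.
by rewrite coefMX /= itE scalerBr !scalerA [z * _]mulrC.
Qed.

(** [w, T w, ..., T^d w] are [d + 1] vectors in a space of dimension [d]. *)
Lemma annihilating_poly V T w d : has_dim V d -> (forall k, V (iter k T w)) ->
  exists2 p : {poly R[i]}, p != 0 & poly_act T p w = 0.
Proof.
move=> [e [_ VE]] VT.
have coord v : V v -> exists c : 'I_d -> R[i], v = \sum_j c j *: e j.
  rewrite VE => -[k [c [x [xe ->]]]].
  have /choice [f xf] : forall i, exists j, x i = e j.
    by move=> i; case: (xe i) => j _ <-; exists j.
  exists (fun j => \sum_(i | f i == j) c i).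
  rewrite (partition_big f predT) //=; apply: eq_bigr => j _.
  by rewrite scaler_suml; apply: eq_bigr => i /eqP <-; rewrite xf.
have /choice [M ME] := fun k => coord _ (VT k).
pose A := \matrix_(i < d.+1, j < d) M i j.
have : kermx A != 0.
  rewrite kermx_eq0 -row_leq_rank -ltnNge ltnS; exact: rank_leq_col.
case/rowV0Pn => r /sub_kermxP rA r0.
pose p := \poly_(i < d.+1) r 0 (inord i).
exists p.
  apply: contra r0 => /eqP p0; apply/eqP/rowP => i.
  have := coef_poly d.+1 (fun i => r 0 (inord i)) i.
  by rewrite -/p p0 coef0 ltn_ord inord_val mxE.
rewrite (poly_act_widen _ _ _ _ (size_poly _ _)).
under eq_bigr => i _ do rewrite coef_poly ltn_ord inord_val ME scaler_sumr.
rewrite exchange_big big1 // => j _.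
under eq_bigr do rewrite scalerA.
rewrite -scaler_suml.
have /rowP/(_ j) := rA; rewrite !mxE.
under eq_bigr do rewrite mxE.
by move=> ->; rewrite scale0r.
Qed.

Definition eigen_sum V T w N (x : 'I_N -> H) (l : 'I_N -> R) := [/\
  forall i, V (x i) /\ T (x i) = (l i)%:C *: x i,
  forall i j, i != j -> ip (x i) (x j) = 0 & w = \sum_i x i].

Section Decompose.
Variables (V : set H) (T : H -> H).
Hypotheses (sV : subspace V) (sT : symmetric_on ip V T).

Lemma ip_eigen_neq u v (a b : R) : V u -> V v -> T u = a%:C *: u ->
  T v = b%:C *: v -> a != b -> ip u v = 0.
Proof.
move=> Vu Vv Tu Tv ab; have := symmetric_ip _ _ _ sT _ _ Vu Vv.
rewrite Tu Tv linearZl_LR linearZr_LR /= conj_real => /eqP.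
rewrite -subr_eq0 -mulrBl mulf_eq0 -rmorphB /= => /orP[|/eqP //].
by rewrite (inj_eq (@complexI R) _ 0) subr_eq0 (negbTE ab).
Qed.

(** One step of the decomposition: the component of [w] on the eigenvalue [z]
    is what remains of [w] once [T - z] has been inverted on the components of
    [(T - z) w]; those never carry the eigenvalue [z]. *)
Lemma eigen_sum_step w (z : R[i]) N x l : V w ->
  eigen_sum V T (T w - z *: w) N x l -> exists N' x' l', eigen_sum V T w N' x' l'.
Proof.
move=> Vw [Ex ox wE].
have x0 j : (l j)%:C = z -> x j = 0.
  move=> lz; have [Vx Tx] := Ex j.
  apply/eqP; rewrite -(dnorm_eq0 ip).
  have -> : ip (x j) (x j) = ip (T w - z *: w) (x j).
    rewrite wE linear_sumlz (bigD1 j) //= big1 ?addr0 // => i ij.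
    exact: ox.
  rewrite linearBl /= (symmetric_ip _ _ _ sT) // Tx linearZl_LR linearZr_LR /=.
  by rewrite conj_real lz subrr.
(* When [l j = z] the inverse is [0], and so is [x j]. *)
pose y j := ((l j)%:C - z)^-1 *: x j.
have Vy j : V (y j) by apply: subspaceZ => //; case: (Ex j).
have Ty j : T (y j) = (l j)%:C *: y j.
  case: (Ex j) => Vx Tx; rewrite (symmetricZ ip V T) // Tx !scalerA.
  by rewrite mulrC.
have yE j : (l j)%:C *: y j = z *: y j + x j.
  have [lz|nz] := eqVneq (l j)%:C z; first by rewrite lz x0 // addr0.
  rewrite -[X in _ + X](scalerKV (a := (l j)%:C - z)) ?subr_eq0 //.
  by rewrite -/(y j) -scalerDl addrCA subrr addr0.
have oy i j : i != j -> ip (y i) (y j) = 0.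
  by move=> ij; rewrite linearZl_LR linearZr_LR /= ox // !mulr0.
pose g := w - \sum_j y j.
have Vs : V (\sum_j y j) by exact: subspace_sum.
have Vg : V g by exact: subspaceB.
have Tg : T g = z *: g.
  rewrite (symmetricB ip V T) // (symmetric_sum ip V T) //.
  rewrite (eq_bigr _ (fun j _ => Ty j)) (eq_bigr _ (fun j _ => yE j)).
  rewrite big_split /= -wE -scaler_sumr scalerBr opprD opprB.
  by rewrite addrCA [T w + _]addrC subrK addrC.
have wgE : w = g + \sum_j y j by rewrite subrK.
have [g0|gn0] := eqVneq g 0.
  by exists N, y, l; split=> //; rewrite {1}wgE g0 add0r.
have zE : z = (complex.Re z)%:C.
  have := symmetric_ip _ _ _ sT _ _ Vg Vg.
  rewrite Tg linearZl_LR linearZr_LR /= => /(mulIf _); rewrite dnorm_eq0.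
  move=> /(_ gn0); case: (z) => p q [] h.
  by congr (_ +i* _); lra.
have og j : ip g (y j) = 0.
  have [lz|nz] := eqVneq (complex.Re z) (l j).
    by rewrite /y x0 ?scaler0 ?linear0r // -lz -zE.
  by apply: (ip_eigen_neq _ _ (complex.Re z) (l j)); rewrite -?zE.
exists N.+1, (fun i => if unlift ord0 i is Some j then y j else g).
exists (fun i => if unlift ord0 i is Some j then l j else complex.Re z).
split=> [i|i j|].
- by case: unliftP => [j|] _ //; rewrite -zE.
- case: (unliftP ord0 i) => [i' ->|->]; case: (unliftP ord0 j) => [j' ->|->] //.
  + by rewrite (inj_eq lift_inj); exact: oy.
  + by rewrite ipC og conjc0.
- rewrite big_ord_recl unlift_none {1}wgE; congr (_ + _).
  by apply: eq_bigr => i _; rewrite liftK.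
Qed.

(** The finite-dimensional spectral theorem, one vector at a time: a polynomial
    that annihilates [w] has a root [z], the quotient annihilates [(T - z) w], and
    the decomposition of the latter yields that of [w]. *)
Lemma exists_eigen_sum w d : has_dim V d -> V w ->
  exists N x l, eigen_sum V T w N x l.
Proof.
move=> dV Vw.
have [p pn0 p0] : exists2 p : {poly R[i]}, p != 0 & poly_act T p w = 0.
  by apply: (annihilating_poly _ _ _ d dV) => k; exact: (iter_stable ip V T sT).
have [n] := ubnP (size p).
elim: n p w Vw pn0 p0 => // n IH p w Vw pn0 p0 lep.
have [/closed_rootP[z]|/negPn/size_poly1P[c cn0 pc]] := boolP (size p != 1%N).
  case/factor_theorem => q pE; rewrite pE in pn0 p0 lep.
  have qn0 : q != 0 by apply: contraNneq pn0 => ->; rewrite mul0r.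
  rewrite (poly_actMXsubC V T q z w sV sT) // in p0.
  have Vw' : V (T w - z *: w).
    apply: subspaceB => //; last exact: subspaceZ.
    exact: (symmetric_stable _ _ _ sT).
  have [|N [x [l E]]] := IH _ _ Vw' qn0 p0; last exact: (eigen_sum_step _ _ _ _ _ Vw E).
  by move: lep; rewrite size_Mmonic ?monicXsubC // size_XsubC addn2.
move: p0; rewrite (poly_act_widen _ _ _ 1) pc ?size_polyC ?cn0 // big_ord1 coefC /=.
move=> /eqP; rewrite scaler_eq0 (negbTE cn0) /= => /eqP ->.
exists 0%N, (fun=> 0), (fun=> 0); split; [by case|by case|by rewrite big_ord0].
Qed.

Lemma galerkin_subspace_sub D : galerkin_subspace V T D `<=` V.
Proof. by apply: lin_span_sub => // v []. Qed.

Lemma galerkin_subspace_stable D u :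
  galerkin_subspace V T D u -> galerkin_subspace V T D (T u).
Proof.
move=> [k [c [x [Xx ->]]]].
have Vx i : V (c i *: x i) by apply: subspaceZ => //; case: (Xx i).
rewrite (symmetric_sum ip V T) //; apply: subspace_sum => [|i].
  exact: lin_span_subspace.
case: (Xx i) => Vxi _ [y _ Ty]; rewrite (symmetricZ ip V T) // Ty.
apply: subspaceZ; first exact: lin_span_subspace.
apply: subspaceZ; first exact: lin_span_subspace.
exact: sub_lin_span.
Qed.

Lemma eigen_sum_self w N x l i : eigen_sum V T w N x l -> ip w (x i) = 0 -> x i = 0.
Proof.
move=> [Ex ox ->]; rewrite linear_sumlz (bigD1 i) //= big1 => [|j ji].
  by rewrite addr0 => /eqP; rewrite dnorm_eq0 => /eqP.
exact: ox.
Qed.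

Lemma eigen_sum_galerkin w D N x l i : galerkin_subspace V T D w ->
  eigen_sum V T w N x l -> D (l i) \/ x i = 0.
Proof.
move=> Gw E; have [|nD] := pselect (D (l i)); [by left | right].
apply: (eigen_sum_self _ _ _ _ _ E); case: E => Ex ox _; have [Vx Tx] := Ex i.
apply: (lin_span_sub _ _ (ortho_subspace ip (x i)) _ _ Gw).
move=> v [Vv _ [y Dy Ty]] /=.
apply: (ip_eigen_neq _ _ y (l i)) => //; apply: contra_notN nD.
by move=> /eqP <-.
Qed.

Lemma eigen_sum_ortho_galerkin w D N x l i :
  (forall v, galerkin_subspace V T D v -> ip w v = 0) ->
  eigen_sum V T w N x l -> ~ D (l i) \/ x i = 0.
Proof.
move=> Gw E; have [Dl|] := pselect (D (l i)); [right | by left].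
apply: (eigen_sum_self _ _ _ _ _ E); case: E => Ex ox _; have [Vx Tx] := Ex i.
have [->|xn0] := eqVneq (x i) 0; first by rewrite linear0r.
by apply/Gw/sub_lin_span; split=> //; exists (l i).
Qed.

Lemma eigen_sum_lower_bound (T' : H -> H) (f : R -> R) (s : R) w N x l :
  symmetric_on ip V T' -> 0 <= s -> eigen_sum V T w N x l ->
  (forall i, T' (x i) = (f (l i))%:C *: x i) ->
  (forall i, s <= `|f (l i)| \/ x i = 0) ->
  s * nr ip w <= nr ip (T' w).
Proof.
move=> sT' s0 [Ex ox ->] Tx fs.
have rx i j : i != j -> rip ip (x i) (x j) = 0.
  by move=> ij; apply/rip_of_ip0/ox.
rewrite (symmetric_sum ip V T') // => [|i]; last by case: (Ex i).
rewrite (eq_bigr _ (fun i _ => Tx i)).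
rewrite -(ler_pXn2r (n := 2)) ?nnegrE ?mulr_ge0 ?nr_ge0 // exprMn.
have -> : \sum_i x i = \sum_i (1 : R)%:C *: x i.
  by apply: eq_bigr => i _; rewrite scale1r.
rewrite !nr_orthogonal_sum // mulr_sumr; apply: ler_sum => i _.
rewrite expr1n mul1r; case: (fs i) => [h|->]; last by rewrite nr0 expr0n !mulr0.
rewrite ler_wpM2r ?sqr_ge0 // -[f _ ^+ 2]real_normK ?num_real //.
by rewrite ler_pXn2r ?nnegrE.
Qed.

End Decompose.
End EigenDecomposition.

(** * Orthogonal projections *)

Section Projections.
Context {R : realType} {H : completeNormedModType R[i]}.
Context (ip : {dot H for (@Num.conj R[i])}).
Variables (M : set H) (E : H -> H).
Hypothesis pE : orthogonal_projection ip M E.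
Implicit Types u v : H.

Lemma projection_ip u v : ip (E u) v = ip u (E v).
Proof.
have h x y : ip x (E y) = ip (E x) (E y).
  have [_ Ex] := pE x; have [My _] := pE y.
  by apply/eqP; rewrite -subr_eq0 -linearBl /= Ex.
by rewrite h ipC h -ipC.
Qed.

Lemma projection_id v : M v -> E v = v.
Proof.
move=> Mv; have [ME orth] := pE v; apply/eqP; rewrite eq_sym -subr_eq0.
by rewrite -(dnorm_eq0 ip) linearBr /= !orth // subrr.
Qed.

(** The defect of linearity is a combination of elements of [M] that is
    orthogonal to [M]. *)
Lemma projection_linear (c : R[i]) u v : E (c *: u + v) = c *: E u + E v.
Proof.
have [Muv ouv] := pE (c *: u + v); have [Mu ou] := pE u; have [Mv ov] := pE v.
set w := E (c *: u + v) - (c *: E u + E v).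
suff : w = 0 by move/subr0_eq.
have ow m : M m -> ip w m = 0.
  move=> Mm; have /= e1 := ouv _ Mm; have /= e2 := ou _ Mm; have /= e3 := ov _ Mm.
  have -> : w = c *: (u - E u) + (v - E v) - (c *: u + v - E (c *: u + v)).
    by rewrite /w scalerBr [RHS]addrC opprB [X in _ = _ + X]addrACA -opprD subrKA.
  by rewrite linearBl /= linearDl /= linearZl_LR /= e1 e2 e3 mulr0 addr0 subr0.
apply/eqP; rewrite -(dnorm_eq0 ip) {2}/w linearBr linearDr linearZr_LR /=.
by rewrite !ow // mulr0 addr0 subr0.
Qed.

Lemma projectionD u v : E (u + v) = E u + E v.
Proof. by have := projection_linear 1 u v; rewrite !scale1r. Qed.

Lemma projection0 : E 0 = 0.
Proof. by apply: (addrI (E 0)); rewrite -projectionD !addr0. Qed.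

Lemma projectionB u v : E (u - v) = E u - E v.
Proof.
by apply/eqP; rewrite eq_sym subr_eq -projectionD subrK.
Qed.

Lemma projection_nr u : nr ip (E u) <= nr ip u.
Proof.
have [E0|] := eqVneq (nr ip (E u)) 0; first by rewrite E0 nr_ge0.
move=> En0; have Ep : 0 < nr ip (E u) by rewrite lt_def En0 nr_ge0.
rewrite -(ler_pM2r Ep) -expr2 nr_sqr; apply: le_trans (rip_le_nr ip u (E u)).
have [ME _] := pE u.
by rewrite /rip projection_ip (projection_id _ ME).
Qed.

End Projections.

(** * Spectral measures *)

Section SpectralMeasure.
Context {R : realType} {H : completeNormedModType R[i]}.
Context (ip : {dot H for (@Num.conj R[i])}).
Variables (A : {linear H -> H}).
Hypothesis (sA : self_adjoint ip A).
Variable P : set (measurableTypeR R) -> H -> H.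
Hypothesis SP : spectral_measure ip A P.
Implicit Types (u v : H) (S : set (measurableTypeR R)).

Lemma spectral_mass u : exists mu : {measure set (measurableTypeR R) -> \bar R},
  [/\ forall S, measurable S -> mu S = (nr ip (P S u) ^+ 2)%:E,
      mu.-integrable setT (EFin : measurableTypeR R -> \bar R) &
      rip ip (A u) u = (\int[mu]_x x)%R].
Proof.
have [mu [muE muI AE]] := spectral_measure_integral SP u.
exists mu; split=> // [S mS|]; last by rewrite /rip AE.
rewrite muE //; congr (_%:E); rewrite nr_sqr /rip.
have pS := spectral_measure_proj SP mS.
by rewrite -(projection_ip _ _ _ pS) (projection_id _ _ _ pS (P S u)) //; exists u.
Qed.

Definition null_part S := forall u, P S u = 0.

Lemma null_partP S u (mu : {measure set (measurableTypeR R) -> \bar R}) :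
  measurable S -> (forall S, measurable S -> mu S = (nr ip (P S u) ^+ 2)%:E) ->
  mu S = 0%E <-> P S u = 0.
Proof.
move=> mS muE; rewrite muE //; split=> [[] /eqP|->].
  by rewrite expf_eq0 /= => /eqP /nr_eq0.
by rewrite nr0 expr0n.
Qed.

Lemma null_part0 : null_part set0.
Proof.
move=> u; have [mu [muE _ _]] := spectral_mass u.
by apply/(null_partP _ _ mu) => //; exact: measure0.
Qed.

(** The masses [|P S u|^2] and [|P (~` S) u|^2] add up to [|u|^2], which leaves
    nothing for the remaining component of [u]. *)
Lemma spectral_split S u : measurable S -> P S u + P (~` S) u = u.
Proof.
move=> mS; have mC := measurableC mS.
have [mu [muE _ _]] := spectral_mass u.
have : mu (S `|` ~` S) = (mu S + mu (~` S))%E.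
  by apply: measureU => //; exact: setICr.
rewrite setUv !muE //.
rewrite (spectral_measureT SP).
case=> h; apply/eqP; rewrite eq_sym -subr_eq0; apply/eqP/(rip_eq0 ip).
have pS := spectral_measure_proj SP mS.
have pC := spectral_measure_proj SP mC.
have self S' : orthogonal_projection ip (range (P S')) (P S') ->
    rip ip u (P S' u) = rip ip (P S' u) (P S' u).
  move=> p; rewrite /rip (projection_ip _ _ _ p u).
  by rewrite (projection_id _ _ _ p (P S' u)) //; exists u.
have o : rip ip (P S u) (P (~` S) u) = 0.
  rewrite /rip (projection_ip _ _ _ pS) -(spectral_measureI SP) //.
  by rewrite setICr null_part0 linear0r.
move: h; rewrite !nr_sqr !ripE !(ripC ip _ u) !(self _ pS) !(self _ pC).
by rewrite (ripC ip (P (~` S) u)) o; lra.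
Qed.

Lemma null_partS S S' : measurable S -> measurable S' -> S `<=` S' ->
  null_part S' -> null_part S.
Proof.
move=> mS mS' /setIidl SS n0 u.
rewrite -SS (spectral_measureI SP) // n0.
exact: (projection0 _ _ _ (spectral_measure_proj SP mS)).
Qed.

(** The spectral subspace [range (P S)], as the set of fixed points of [P S]. *)
Definition spectral_part S : set H := [set u | P S u = u].

Lemma spectral_part_proj S u : measurable S -> spectral_part S (P S u).
Proof.
move=> mS; apply: (projection_id _ _ _ (spectral_measure_proj SP mS)).
by exists u.
Qed.

Lemma spectral_part_subspace S : measurable S -> subspace (spectral_part S).
Proof.
move=> mS; have pS := spectral_measure_proj SP mS.
split=> [|c u v Su Sv]; first exact: (projection0 _ _ _ pS).
by rewrite /spectral_part /= (projection_linear _ _ _ pS) Su Sv.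
Qed.

Lemma spectral_partC S u : measurable S -> P (~` S) u = 0 -> spectral_part S u.
Proof.
by move=> mS h; rewrite /spectral_part /= -[RHS](spectral_split S u mS) h addr0.
Qed.

Lemma spectral_part_disjoint S S' u v : measurable S -> measurable S' ->
  S `&` S' = set0 -> spectral_part S u -> spectral_part S' v -> ip u v = 0.
Proof.
move=> mS mS' SS' <- <-.
rewrite (projection_ip _ _ _ (spectral_measure_proj SP mS)).
by rewrite -(spectral_measureI SP) // SS' null_part0 linear0r.
Qed.

Lemma spectral_part_comm S S' u : measurable S -> measurable S' ->
  spectral_part S u -> spectral_part S (P S' u).
Proof.
move=> mS mS' Su; rewrite /spectral_part /= -(spectral_measureI SP) //.
by rewrite setIC (spectral_measureI SP) // Su.
Qed.

(** The measures of [u] and [v] add up to that of [u + v] when [u] and [v] lie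
    in complementary spectral subspaces, hence so do the quadratic forms. *)
Lemma form_split S u v : measurable S -> spectral_part S u ->
  spectral_part (~` S) v -> rip ip (A (u + v)) (u + v) =
  rip ip (A u) u + rip ip (A v) v.
Proof.
move=> mS Su Sv; have mC := measurableC mS.
have [m1 [m1E m1I ->]] := spectral_mass u.
have [m2 [m2E m2I ->]] := spectral_mass v.
have [m3 [m3E m3I ->]] := spectral_mass (u + v).
rewrite /Rintegral (eq_measure_integral (measure_add m1 m2)) => [|X mX _].
  rewrite integral_measure_add //.
  by rewrite fineD //; apply: integrable_fin_num.
rewrite m3E // -[RHS]/(measure_add m1 m2 X) measure_addE m1E // m2E // -EFinD.
congr (_%:E).
rewrite (projectionD _ _ _ (spectral_measure_proj SP mX)).
apply/nr_pythagoras/rip_of_ip0/(spectral_part_disjoint _ _ _ _ mS mC).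
- exact: setICr.
- exact: spectral_part_comm.
- exact: spectral_part_comm.
Qed.

(** [A u] is orthogonal to the complementary spectral subspace: [form_split] gives
    [2 rip (A u) v = 0] for [v] there. *)
Lemma spectral_part_stable S u : measurable S ->
  spectral_part S u -> spectral_part S (A u).
Proof.
move=> mS Su; have mC := measurableC mS.
have o v : spectral_part (~` S) v -> rip ip (A u) v = 0.
  move=> Sv; have := form_split _ _ _ mS Su Sv.
  rewrite raddfD /= !ripE.
  have -> : rip ip (A v) u = rip ip (A u) v by rewrite ripC /rip -sA.
  by move=> h; lra.
apply: spectral_partC => //; set y := P _ _.
have Sy : spectral_part (~` S) y by exact: spectral_part_proj.
apply: (rip_eq0 ip); rewrite /rip {1}/y.
rewrite (projection_ip _ _ _ (spectral_measure_proj SP mC)) Sy.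
exact: o.
Qed.

Lemma spectral_part_symmetric S : measurable S ->
  symmetric_on ip (spectral_part S) A.
Proof.
move=> mS; split=> [u|c u v _ _|u v _ _].
- exact: spectral_part_stable.
- by rewrite linearP.
- exact: sA.
Qed.

(** For [u] in the spectral subspace of [S] the mass of [u] is carried by [S], so
    the integral that represents the form may be restricted to [S]. *)
Lemma spectral_part_form S u : measurable S -> spectral_part S u ->
  exists mu : {measure set (measurableTypeR R) -> \bar R},
  [/\ mu S = (nr ip u ^+ 2)%:E,
      mu.-integrable S (EFin : measurableTypeR R -> \bar R),
      (forall k : R, mu.-integrable S (EFin \o (fun _ : measurableTypeR R => k))) &
      rip ip (A u) u = (\int[mu]_(x in S) x)%R].
Proof.
move=> mS Su; have [mu [muE muI ->]] := spectral_mass u.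
have mC := measurableC mS.
exists mu; split; first by rewrite muE // Su.
- exact: integrableS muI.
- move=> k; apply/integrableP; split; first exact: measurable_cst.
  by rewrite (integral_cst mu mS (`|k|%:E)) muE // -EFinM ltry.
- rewrite /Rintegral (negligible_integral mC) //; first by rewrite setDE setCK setTI.
  apply/(null_partP _ u) => //.
  by rewrite -Su -(spectral_measureI SP) // setICl null_part0.
Qed.

Lemma spectral_part_upper S u (k : R) : measurable S -> (forall x, S x -> x <= k) ->
  spectral_part S u -> rip ip (A u) u <= k * nr ip u ^+ 2.
Proof.
move=> mS Sk Su; have [mu [muS muI muk ->]] := spectral_part_form _ _ mS Su.
have := Rintegral_cst mu mS k; rewrite muS /= => <-.
exact: le_Rintegral.
Qed.

Lemma spectral_part_lower S u (k : R) : measurable S -> (forall x, S x -> k <= x) ->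
  spectral_part S u -> k * nr ip u ^+ 2 <= rip ip (A u) u.
Proof.
move=> mS Sk Su; have [mu [muS muI muk ->]] := spectral_part_form _ _ mS Su.
have := Rintegral_cst mu mS k; rewrite muS /= => <-.
exact: le_Rintegral.
Qed.

Lemma spectral_part_nr_le S u (c s : R) : measurable S -> 0 < s ->
  (forall x, S x -> c - s <= x <= c + s) ->
  spectral_part S u -> nr ip (A u - c%:C *: u) <= s * nr ip u.
Proof.
move=> mS s0 Sb Su.
have sS := spectral_part_subspace _ mS.
have sT := symmetric_shift ip _ _ sS (spectral_part_symmetric _ mS) c.
apply: (nr_le_form ip _ _ sS sT _ s0) => // v Sv.
have h1 := spectral_part_upper S v (c + s) mS (fun x Sx => proj2 (andP (Sb x Sx))) Sv.
have h2 := spectral_part_lower S v (c - s) mS (fun x Sx => proj1 (andP (Sb x Sx))) Sv.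
rewrite ripBl ripZl ler_norml -nr_sqr.
by apply/andP; split; lra.
Qed.

Definition uncharged : set R := [set x | exists2 e : R, 0 < e &
  null_part (`[x - e, x + e]%classic : set (measurableTypeR R))].

(** Each point of [S] lies in an uncharged interval with rational endpoints, and
    there are countably many of those. *)
Lemma null_part_uncharged S : measurable S -> S `<=` uncharged -> null_part S.
Proof.
move=> mS SU u; have [mu [muE _ _]] := spectral_mass u.
apply/(null_partP _ _ mu) => //; apply/negligibleP => //.
have [f fE] : exists f : nat -> option (rat * rat), forall pq, exists k, f k = Some pq.
  by exists unpickle => pq; exists (pickle pq); exact: pickleK.
pose J (pq : rat * rat) : set (measurableTypeR R) :=
  `[ratr pq.1, ratr pq.2]%classic.
pose F k := if f k is Some pq then
  (if pselect (null_part (J pq)) then J pq else set0) else set0.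
have : S `<=` \bigcup_k F k.
  move=> x Sx.
  have [e e0 ne] := SU _ Sx.
  have [p] := @rat_in_itvoo R (x - e) x (ltac:(lra)); rewrite in_itv /= => /andP[p1 p2].
  have [q] := @rat_in_itvoo R x (x + e) (ltac:(lra)); rewrite in_itv /= => /andP[q1 q2].
  have [k fk] := fE (p, q).
  exists k; first by [].
  rewrite /F fk; case: pselect => [n0|/= []].
    by rewrite /J /= in_itv /= !ltW.
  apply: (null_partS _ _ _ _ _ ne); do ?exact: measurable_itv.
  by move=> y; rewrite /J /= !in_itv /= => /andP[h1 h2]; apply/andP; split; lra.
move/negligibleS; apply; apply: negligible_bigcup => k; rewrite /F.
case: (f k) => [pq|]; last exact: negligible_set0.
case: pselect => [n0|n0]; last exact: negligible_set0.
apply/negligibleP; first exact: measurable_itv.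
by apply/(null_partP _ u) => //; exact: measurable_itv.
Qed.

Lemma uncharged_near x : uncharged x -> exists2 e : R, 0 < e &
  forall y, `|y - x| < e -> uncharged y.
Proof.
move=> [e e0 ne]; exists e => // y; rewrite ltr_norml => /andP[h1 h2].
exists (Num.min (e + (y - x)) (e - (y - x))).
  by rewrite lt_min; apply/andP; split; lra.
apply: (null_partS _ _ _ _ _ ne); do ?exact: measurable_itv.
move=> z /=; rewrite !in_itv /= => /andP[h3 h4].
have := ge_min (e + (y - x)) (e + (y - x)) (e - (y - x)); rewrite lexx /= => m1.
have := ge_min (e - (y - x)) (e + (y - x)) (e - (y - x)); rewrite lexx orbT => m2.
by apply/andP; split; lra.
Qed.

Hypothesis Hip : hilbert_norm ip.

Lemma bounded_nr (B : H -> H) : bounded_operator B ->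
  exists2 C : R, 0 < C & forall u, nr ip (B u) <= C * nr ip u.
Proof.
move=> [c cB]; pose C : R := complex.Re `|c|.
have cE : `|c| = C%:C by rewrite RRe_real // normr_real.
have C0 : 0 <= C by rewrite -ler0c -cE normr_ge0.
exists (C + 1) => [|u]; first by lra.
have h : `|B u| <= C%:C * `|u|.
  rewrite -cE -[`|u|]normr_id -normrM ger0_norm; first exact: cB.
  exact: le_trans (normr_ge0 _) (cB u).
move: h; rewrite !(normE ip Hip) -rmorphM lecR => h.
by apply: le_trans h _; rewrite ler_wpM2r ?nr_ge0 // lerDl.
Qed.

(** On the spectral subspace of an interval of radius [e] around [x], [A - x] has
    norm at most [e], but it is bounded below by [1 / C] with [C] a bound for the
    resolvent: if [e < 1 / C] this subspace is trivial. *)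
Lemma resolvent_uncharged (x : R) : resolvent_set A x%:C -> uncharged x.
Proof.
move=> [B [bB BK _]]; have [C C0 BC] := bounded_nr _ bB.
have e0 : 0 < (2 * C)^-1 by rewrite invr_gt0 mulr_gt0.
(* The radius is half of [1 / C], for a strict contraction. *)
exists (2 * C)^-1 => // u; set S := (X in P X u).
have mS : measurable S by exact: measurable_itv.
have Sb y : S y -> x - (2 * C)^-1 <= y <= x + (2 * C)^-1 by rewrite /S /= in_itv.
have := spectral_part_nr_le S (P S u) x _ mS e0 Sb (spectral_part_proj _ _ mS).
have := BC (A (P S u) - x%:C *: P S u); rewrite (BK (P S u)).
set v := P S u; move=> h1 h2.
apply: (nr_eq0 ip); apply/eqP; rewrite eq_le nr_ge0 andbT.
have : C * nr ip (A v - x%:C *: v) <= C * ((2 * C)^-1 * nr ip v).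
  by rewrite ler_wpM2l // ltW.
rewrite mulrA invfM [2^-1 * _]mulrC mulrA mulfV ?gt_eqF // mul1r.
by move=> h3; lra.
Qed.

End SpectralMeasure.

(** * Powers separate the two parts of the spectrum *)

Section SpectralGap.
Context {R : realType} {H : completeNormedModType R[i]}.
Context (ip : {dot H for (@Num.conj R[i])}).
Variables (A : {linear H -> H}).
Hypothesis (sA : self_adjoint ip A).
Hypothesis Hip : hilbert_norm ip.
Variable P : set (measurableTypeR R) -> H -> H.
Hypothesis SP : spectral_measure ip A P.
Variables a b : R.
Hypothesis ab : a < b.
Local Notation c := ((a + b) / 2).
Local Notation r := ((b - a) / 2).
Implicit Types u v : H.

Definition shifted (T : H -> H) (c : R) u := T u - c%:C *: u.

(** For [K] large, this is a positive operator that is small where the spectrum of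
    [T] is far from [c] and large where it is close to [c]. *)
Definition capped (T : H -> H) (c K : R) u :=
  K%:C *: u - shifted T c (shifted T c u).

Lemma spectral_form_ge (m : R) u : (forall x, x < m -> resolvent_set A x%:C) ->
  m * nr ip u ^+ 2 <= rip ip (A u) u.
Proof.
move=> rm; pose S : set (measurableTypeR R) := `[m, +oo[%classic.
have mS : measurable S by exact: measurable_itv.
apply: (spectral_part_lower _ _ _ SP S) => // [x|].
  by rewrite /S /= in_itv /= andbT.
apply: (spectral_partC _ _ _ SP) => //.
apply: (null_part_uncharged _ _ _ SP); first exact: measurableC.
move=> x Sx; apply: (resolvent_uncharged _ _ sA _ SP Hip).
by apply: rm; rewrite ltNge; apply/negP => h; apply: Sx; rewrite /S /= in_itv /= h.
Qed.

Lemma rip_lower_bound (k : R) u v :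
  (k * nr ip u ^+ 2 <= rip ip v u) \/ (rip ip v u <= - (k * nr ip u ^+ 2)) ->
  k * nr ip u <= nr ip v.
Proof.
move=> h; have [u0|un0] := eqVneq (nr ip u) 0; first by rewrite u0 mulr0 nr_ge0.
have up : 0 < nr ip u by rewrite lt_def un0 nr_ge0.
rewrite -(ler_pM2r up) -mulrA -expr2.
case: h => h; first exact: le_trans h (rip_le_nr _ _ _).
have := rip_le_nr ip (- v) u; rewrite nrN ripNl; lra.
Qed.

Variable D : set (measurableTypeR R).
Hypothesis mD : measurable D.
Hypothesis Dab : D `<=` `[a, b].
Hypothesis DC : forall x, x \in `[a, b] -> ~ D x -> uncharged P x.
Variable e : R.
Hypothesis e0 : 0 < e.
Hypothesis er : e < r.
Hypothesis ea : forall x, `|x - a| < e -> uncharged P x.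
Hypothesis eb : forall x, `|x - b| < e -> uncharged P x.

(** On the range of [P D] the spectrum of [A] stays at distance at most [r - e]
    from the midpoint [c] of [[a, b]]. *)
Lemma iter_shifted_le u : P D u = u ->
  forall k, nr ip (iter k (shifted A c) u) <= (r - e) ^+ k * nr ip u.
Proof.
move=> Du k; have [[abp e0p] erp] := (ab, e0, er).
pose S : set (measurableTypeR R) := `[a + e, b - e]%classic.
have mS : measurable S by exact: measurable_itv.
have Su : spectral_part P S u.
  apply: (spectral_partC _ _ _ SP) => //.
  rewrite -Du -(spectral_measureI SP) //; last exact: measurableC.
  apply: (null_part_uncharged _ _ _ SP).
    by apply: measurableI => //; exact: measurableC.
  move=> x [nSx /Dab]; rewrite /= in_itv /= => /andP[ax xb].
  have [h|h] := ltP x (a + e).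
    by apply: ea; rewrite ger0_norm; lra.
  have [h'|h'] := ltP (b - e) x.
    by apply: eb; rewrite ler0_norm; lra.
  by case: nSx; rewrite /S /= in_itv /= h h'.
have sS := spectral_part_subspace _ _ _ SP S mS.
have sT := symmetric_shift ip _ _ sS (spectral_part_symmetric _ _ sA _ SP _ mS) c.
apply: (nr_iter_le ip _ _ sT (r - e)) => // [|v Sv].
  by rewrite subr_ge0 ltW.
apply: (spectral_part_nr_le _ _ sA _ SP S) => //; first by rewrite subr_gt0.
by move=> x; rewrite /S /= in_itv /= => /andP[h1 h2]; apply/andP; split; lra.
Qed.

Variable C : R.
Hypothesis C0 : 0 <= C.
Hypothesis AC : forall u, nr ip (shifted A c u) <= C * nr ip u.

Let J : set (measurableTypeR R) := `]a - e, b + e[%classic.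

Lemma spectral_part_outer u : P D u = 0 -> spectral_part P (~` J) u.
Proof.
move=> Du0; have [[abp e0p] erp] := (ab, e0, er).
have mJ : measurable J by exact: measurable_itv.
apply: (spectral_partC _ _ _ SP); rewrite ?setCK //; first exact: measurableC.
rewrite -(spectral_split _ _ _ SP D (P J u)) //.
have -> : P D (P J u) = 0.
  rewrite -(spectral_measureI SP mD mJ) setIC (spectral_measureI SP mJ mD) Du0.
  exact: (projection0 _ _ _ (spectral_measure_proj SP mJ)).
rewrite add0r -(spectral_measureI SP (measurableC mD) mJ).
apply: (null_part_uncharged _ _ _ SP).
  by apply: measurableI => //; exact: measurableC.
move=> x [nDx]; rewrite /J /= in_itv /= => /andP[ax xb].
have [h|h] := ltP x a; first by apply: ea; rewrite ler0_norm; lra.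
have [h'|h'] := ltP b x; first by apply: eb; rewrite ger0_norm; lra.
by apply: DC => //; rewrite in_itv /= h h'.
Qed.

(** The kernel of [P D] splits into the spectral subspaces to the left of [a - e]
    and to the right of [b + e]; [A - c] is of one sign on each and respects their
    orthogonality. *)
Lemma shifted_outer_lower u : spectral_part P (~` J) u ->
  (r + e) ^+ 2 * nr ip u ^+ 2 <= nr ip (shifted A c u) ^+ 2.
Proof.
move=> Ju; have [[abp e0p] erp] := (ab, e0, er).
have mJ : measurable J by exact: measurable_itv.
have mCJ := measurableC mJ.
pose S : set (measurableTypeR R) := `]-oo, a - e]%classic.
have mS : measurable S by exact: measurable_itv.
have mCS := measurableC mS.
pose S' : set (measurableTypeR R) := `[b + e, +oo[%classic.
have mS' : measurable S' by exact: measurable_itv.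
have SJ : ~` S `&` ~` J `<=` S'.
  move=> x [Sx Jx]; rewrite /S' /= in_itv /= andbT leNgt; apply/negP => h.
  apply: Jx; rewrite /J /= in_itv /= h andbT ltNge; apply/negP => h'.
  by apply: Sx; rewrite /S /= in_itv.
have bea : (b + e <= a - e) = false by apply/negbTE; rewrite -ltNge; lra.
have SS' : S `&` S' = set0.
  apply/seteqP; split=> x //; rewrite /S /S' /= !in_itv /= andbT => -[].
  by move=> h1 h2; have := le_trans h2 h1; rewrite bea.
set v := P S u; set v' := P (~` S) u.
have uE : u = v + v' by rewrite (spectral_split _ _ _ SP).
have Sv : spectral_part P S v by exact: (spectral_part_proj _ _ _ SP).
have Sv' : spectral_part P S' v'.
  have mCSJ := measurableI _ _ mCS mCJ.
  have -> : v' = P (~` S `&` ~` J) u by rewrite (spectral_measureI SP) // Ju.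
  by rewrite /spectral_part /= -(spectral_measureI SP) // (setIidr SJ).
have shift_part X w : measurable X -> spectral_part P X w ->
    spectral_part P X (shifted A c w).
  move=> mX Xw; have sX := spectral_part_subspace _ _ _ SP _ mX.
  apply: (subspaceB sX); last exact: (subspaceZ _ sX).
  exact: (spectral_part_stable _ _ sA _ SP).
have -> : shifted A c u = shifted A c v + shifted A c v'.
  by rewrite {1}uE /shifted raddfD scalerDr opprD addrACA.
rewrite {1}uE (nr_pythagoras _ v v') ?(nr_pythagoras _ (shifted A c v)); last 2 first.
- by apply/rip_of_ip0/(spectral_part_disjoint _ _ _ SP S S') => //; exact: shift_part.
- by apply/rip_of_ip0/(spectral_part_disjoint _ _ _ SP S S') => //; exact: shift_part.
move=> {uE}; have re0 : 0 <= r + e by lra.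
rewrite mulrDr -!exprMn; apply: lerD; rewrite ler_pXn2r ?nnegrE ?mulr_ge0 ?nr_ge0 //.
  apply: rip_lower_bound; right.
  have := spectral_part_upper _ _ _ SP S v (a - e) mS _ Sv.
  rewrite ripBl ripZl -!nr_sqr => h.
  have : rip ip (A v) v <= (a - e) * nr ip v ^+ 2.
    by apply: h => x; rewrite /S /= in_itv.
  by lra.
apply: rip_lower_bound; left.
have := spectral_part_lower _ _ _ SP S' v' (b + e) mS' _ Sv'.
rewrite ripBl ripZl -!nr_sqr => h.
have : (b + e) * nr ip v' ^+ 2 <= rip ip (A v') v'.
  by apply: h => x; rewrite /S' /= in_itv /= andbT.
by lra.
Qed.

(** On the kernel of [P D] the spectrum of [A] is at distance at least [r + e]
    from [c]. *)
Lemma iter_capped_le (K : R) u : C ^+ 2 <= K -> (r + e) ^+ 2 < K -> P D u = 0 ->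
  forall k, nr ip (iter k (capped A c K) u) <= (K - (r + e) ^+ 2) ^+ k * nr ip u.
Proof.
move=> CK rK Du0 k; have [[abp e0p] erp] := (ab, e0, er).
have mJ : measurable J by exact: measurable_itv.
have mCJ := measurableC mJ.
have sS := spectral_part_subspace _ _ _ SP _ mCJ.
have sT := symmetric_shift ip _ _ sS (spectral_part_symmetric _ _ sA _ SP _ mCJ) c.
have sB := symmetric_csub_sqr ip _ _ sS sT K.
have s0 : 0 < K - (r + e) ^+ 2 by rewrite subr_gt0.
apply: (nr_iter_le ip _ _ sB); [exact: ltW | | exact: spectral_part_outer].
apply: (nr_le_form ip _ _ sS sB _ s0) => v Jv.
have := shifted_outer_lower _ Jv.
have h : nr ip (shifted A c v) ^+ 2 <= K * nr ip v ^+ 2.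
  apply: (le_trans (y := C ^+ 2 * nr ip v ^+ 2)); last by rewrite ler_wpM2r ?sqr_ge0.
  by rewrite -exprMn ler_pXn2r ?nnegrE ?mulr_ge0 ?nr_ge0.
rewrite ripBl ripZl (symmetric_rip ip _ _ sT) //; last exact: (symmetric_stable _ _ _ sT).
rewrite -/(shifted A c v) -!nr_sqr => h'.
have := mulr_ge0 (ltW s0) (sqr_ge0 (nr ip v)) => h''.
by rewrite ler_norml; apply/andP; split; lra.
Qed.

End SpectralGap.

(** * Galerkin approximation *)

Section Galerkin.
Context {R : realType} {H : completeNormedModType R[i]}.
Context (ip : {dot H for (@Num.conj R[i])}).
Hypothesis Hip : hilbert_norm ip.
Variables (A : {linear H -> H}).
Hypothesis (sA : self_adjoint ip A).
Implicit Types u v w l : H.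

Definition tends_to (x : nat -> H) l :=
  forall e : R, 0 < e -> \forall n \near \oo, nr ip (x n - l) < e.

Lemma tends_to_le (x y z : nat -> H) l l' l'' (C C' : R) : 0 <= C -> 0 <= C' ->
  (forall n, nr ip (z n - l'') <= C * nr ip (x n - l) + C' * nr ip (y n - l')) ->
  tends_to x l -> tends_to y l' -> tends_to z l''.
Proof.
move=> C0 C'0 h xl yl e e0.
have p0 : 0 < C + C' + 1 by lra.
pose d := e / (C + C' + 1).
have d0 : 0 < d by exact: divr_gt0.
have eE : e = (C + C' + 1) * d by rewrite mulrCA mulfV ?gt_eqF ?mulr1.
near=> n; apply: le_lt_trans (h n) _; rewrite eE.
have h1 : nr ip (x n - l) < d by near: n; exact: xl.
have h2 : nr ip (y n - l') < d by near: n; exact: yl.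
have := ler_wpM2l C0 (ltW h1); have := ler_wpM2l C'0 (ltW h2); lra.
Unshelve. all: by end_near. Qed.

Lemma tends_toB (x y : nat -> H) l l' : tends_to x l -> tends_to y l' ->
  tends_to (fun n => x n - y n) (l - l').
Proof.
apply: (tends_to_le _ _ _ _ _ _ 1 1) => // n; rewrite !mul1r.
by rewrite opprD addrACA -opprD; exact: nrB.
Qed.

Lemma tends_toZ (k : R) (x : nat -> H) l : tends_to x l ->
  tends_to (fun n => k%:C *: x n) (k%:C *: l).
Proof.
move=> xl; apply: (tends_to_le _ _ _ _ _ _ `|k| 0 _ _ _ xl xl) => // n.
by rewrite mul0r addr0 -scalerBr nrZ.
Qed.

Section Operator.
Variables (V : set H) (T : H -> H).
Hypothesis sV : subspace V.
Hypothesis gT : galerkin_operator ip A V T.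

Lemma galerkin_symmetric : symmetric_on ip V T.
Proof.
have VT u : V u -> V (T u) by move=> /gT[].
have Tip u v : V u -> V v -> ip (T u) v = ip (A u) v by move=> /gT[_]; apply.
split=> // [c u v Vu Vv|u v Vu Vv].
  have Vcuv : V (c *: u + v) by case: sV => _; apply.
  have Vc : V (c *: T u + T v) by case: sV => _; apply; exact: VT.
  have Vd := subspaceB sV (VT _ Vcuv) Vc.
  apply/eqP; rewrite -subr_eq0 -(dnorm_eq0 ip) {1}linearBl /= Tip //.
  rewrite [X in _ - X]linearPl /= !Tip // linearP linearPl /= subrr //.
by rewrite Tip // sA ipC -(Tip v u) // -ipC.
Qed.

(** Galerkin orthogonality makes [T u] the best approximation of [A u] in [V], so
    [An] inherits convergence to [A] from the density of the [L n]. *)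
Lemma galerkin_best u v : V u -> V v -> nr ip (T u - v) <= nr ip (A u - v).
Proof.
move=> Vu Vv; have [VTu Tu] := gT u Vu.
have [d0|dn0] := eqVneq (nr ip (T u - v)) 0; first by rewrite d0 nr_ge0.
have dp : 0 < nr ip (T u - v) by rewrite lt_def dn0 nr_ge0.
rewrite -(ler_pM2r dp) -expr2 nr_sqr.
apply: le_trans (rip_le_nr ip (A u - v) (T u - v)).
by rewrite !(ripBl ip _ v) {1}/rip Tu //; exact: subspaceB.
Qed.

End Operator.

(** The component [z] of [u] in the invariant set [N] cannot be larger after
    applying [T^k] than [u] itself: by symmetry [T^k u - T^k z] is still orthogonal
    to [N]. *)
Lemma component_bound (V N : set H) (T : H -> H) (s : R) k z u :
  symmetric_on ip V T -> N `<=` V -> (forall w, N w -> N (T w)) -> 0 <= s ->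
  (forall w, N w -> s * nr ip w <= nr ip (T w)) ->
  V u -> N z -> (forall w, N w -> rip ip (u - z) w = 0) ->
  s ^+ k * nr ip z <= nr ip (iter k T u).
Proof.
move=> sT NV NT s0 low Vu Nz orth.
have Nk w j : N w -> N (iter j T w) by move=> Nw; elim: j => //= j; exact: NT.
apply: (le_trans (y := nr ip (iter k T z))).
  elim: k => [|k IH]; first by rewrite expr0 mul1r.
  rewrite exprS -mulrA; apply: le_trans (low _ (Nk _ k Nz)).
  by rewrite ler_wpM2l.
have [d0|dn0] := eqVneq (nr ip (iter k T z)) 0; first by rewrite d0 nr_ge0.
have dp : 0 < nr ip (iter k T z) by rewrite lt_def dn0 nr_ge0.
rewrite -(ler_pM2r dp) -expr2 nr_sqr.
apply: le_trans (rip_le_nr _ _ _).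
rewrite (iter_symmetric_rip ip V T sT k u) //; last exact/NV/Nk.
rewrite -[u in X in _ <= X](subrK z) ripDl orth ?add0r; last exact/Nk/Nk.
by rewrite (iter_symmetric_rip ip V T sT) //; exact/NV/Nk || exact: NV.
Qed.

(** For fixed [k], [f n] is at most [|x k n| / s^k], which tends to
    [|l k| / s^k <= (t / s)^k M]; then let [k] grow. *)
Lemma geometric_squeeze (f : nat -> R) (x : nat -> nat -> H) (l : nat -> H)
  (s t M : R) : 0 <= t -> t < s -> (forall n, 0 <= f n) ->
  (forall k n, s ^+ k * f n <= nr ip (x k n)) ->
  (forall k, tends_to (x k) (l k)) -> (forall k, nr ip (l k) <= t ^+ k * M) ->
  forall e : R, 0 < e -> \forall n \near \oo, f n < e.
Proof.
move=> t0 ts f0 fx xl lM e ep.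
have s0 : 0 < s by exact: le_lt_trans ts.
have q1 : `|t / s| < 1.
  rewrite ger0_norm; first by rewrite ltr_pdivrMr // mul1r.
  by rewrite divr_ge0 // ltW.
have [k kM] : exists k, (t / s) ^+ k * M < e / 2.
  have : (fun k => (t / s) ^+ k * M) @ \oo --> (0 * M : R).
    by apply: cvgM; [exact: cvg_expr | exact: cvg_cst].
  rewrite mul0r => /cvgr_lt /(_ (e / 2)) []; first by rewrite divr_gt0.
  by move=> k _ /(_ k (leqnn k)) h; exists k.
have sk : 0 < s ^+ k by exact: exprn_gt0.
near=> n.
have h : nr ip (x k n - l k) < s ^+ k * (e / 2).
  by near: n; apply: xl; rewrite mulr_gt0 // divr_gt0.
rewrite -(ltr_pM2l sk); apply: le_lt_trans (fx k n) _.
rewrite -[x k n](subrK (l k)); apply: le_lt_trans (nrD _ _ _) _.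
have h' : nr ip (l k) < s ^+ k * (e / 2).
  apply: le_lt_trans (lM k) _.
  have -> : t ^+ k * M = s ^+ k * ((t / s) ^+ k * M).
    by rewrite [RHS]mulrA -exprMn mulrCA mulfV ?gt_eqF // mulr1.
  by rewrite ltr_pM2l.
lra.
Unshelve. all: by end_near. Qed.

Variables (L : nat -> set H) (An : nat -> H -> H).
Hypothesis sL : forall n, subspace (L n).
Hypothesis gA : forall n, galerkin_operator ip A (L n) (An n).
Hypothesis dL : forall u, exists2 w : nat -> H, (forall n, L n (w n)) & tends_to w u.
Variable CA : R.
Hypothesis CA0 : 0 <= CA.
Hypothesis bA : forall u, nr ip (A u) <= CA * nr ip u.

(** Strong convergence of [T n] to [B] along convergent sequences of trial
    vectors; this form is stable under composition. *)
Definition galerkin_cvg (T : nat -> H -> H) (B : H -> H) := forall x l,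
  (forall n, L n (x n)) -> tends_to x l ->
  (forall n, L n (T n (x n))) /\ tends_to (fun n => T n (x n)) (B l).

Lemma galerkin_cvg_op : galerkin_cvg An A.
Proof.
move=> x l Lx xl; split=> [n|]; first by have [] := gA n _ (Lx n).
have [y Ly yl] := dL (A l).
apply: (tends_to_le _ _ _ _ _ _ CA 2 _ _ _ xl yl) => // n.
have h1 := galerkin_best _ _ (sL n) (gA n) _ _ (Lx n) (Ly n).
have h2 := bA (x n - l); rewrite raddfB /= in h2.
have h3 : nr ip (An n (x n) - A l) <=
    nr ip (An n (x n) - y n) + nr ip (y n - A l).
  by rewrite -[X in nr ip X](subrKA (y n)); exact: nrD.
have h4 : nr ip (A (x n) - y n) <= nr ip (A (x n) - A l) + nr ip (y n - A l).
  by rewrite -[y n - A l]opprB nrN -[X in nr ip X <= _](subrKA (A l)); exact: nrD.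
lra.
Qed.

Lemma galerkin_cvg_shifted (T : nat -> H -> H) B (c : R) : galerkin_cvg T B ->
  galerkin_cvg (fun n => shifted (T n) c) (shifted B c).
Proof.
move=> TB x l Lx xl; have [LT Tl] := TB _ _ Lx xl.
split=> [n|]; last by apply: tends_toB => //; exact: tends_toZ.
by apply: (subspaceB (sL n)) => //; exact: (subspaceZ _ (sL n)).
Qed.

Lemma galerkin_cvg_capped (T : nat -> H -> H) B (c K : R) : galerkin_cvg T B ->
  galerkin_cvg (fun n => capped (T n) c K) (capped B c K).
Proof.
move=> /(galerkin_cvg_shifted _ _ c) TB x l Lx xl.
have [LT Tl] := TB _ _ Lx xl; have [LTT TTl] := TB _ _ LT Tl.
split=> [n|]; last by apply: tends_toB => //; exact: tends_toZ.
by apply: (subspaceB (sL n)) => //; exact: (subspaceZ _ (sL n)).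
Qed.

Lemma galerkin_cvg_iter (T : nat -> H -> H) B k : galerkin_cvg T B ->
  galerkin_cvg (fun n => iter k (T n)) (iter k B).
Proof.
move=> TB; elim: k => [|k IH] x l Lx xl //=.
by have [LT Tl] := IH _ _ Lx xl; exact: TB.
Qed.

End Galerkin.

Section GalerkinProjection.
Context {R : realType} {H : completeNormedModType R[i]}.
Context (ip : {dot H for (@Num.conj R[i])}).
Hypothesis Hip : hilbert_norm ip.
Variables (A : {linear H -> H}).
Hypothesis (sA : self_adjoint ip A).
Variables a b : R.
Hypothesis ab : a < b.
Local Notation c := ((a + b) / 2).
Local Notation r := ((b - a) / 2).
Variables (L : nat -> set H) (An Q : nat -> H -> H).
Hypothesis sL : forall n, subspace (L n).
Hypothesis fL : forall n, finite_dim (L n).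
Hypothesis gA : forall n, galerkin_operator ip A (L n) (An n).
Hypothesis dL : forall u, exists2 w : nat -> H,
  (forall n, L n (w n)) & tends_to ip w u.
Hypothesis bA : bounded_operator A.
Local Notation G n := (galerkin_subspace (L n) (An n) `[a, b]).
Hypothesis pQ : forall n, orthogonal_projection ip (G n) (Q n).
Implicit Types u v w : H.

Let sAn n : symmetric_on ip (L n) (An n).
Proof. exact: (galerkin_symmetric _ _ sA _ _ (sL n) (gA n)). Qed.

Let sTn n : symmetric_on ip (L n) (shifted (An n) c).
Proof. exact: (symmetric_shift ip _ _ (sL n) (sAn n)). Qed.

Let GL n : G n `<=` L n.
Proof. exact: (galerkin_subspace_sub _ _ (sL n)). Qed.

Let Gs n : subspace (G n).
Proof. exact: lin_span_subspace. Qed.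

Let G_shifted n w : G n w -> G n (shifted (An n) c w).
Proof.
move=> Gw; apply: (subspaceB (Gs n)); last exact: (subspaceZ _ (Gs n)).
exact: (galerkin_subspace_stable ip _ _ (sL n) (sAn n)).
Qed.

Let An_cvg : galerkin_cvg ip L An A.
Proof.
have [C C0 bC] := bounded_nr ip Hip _ bA.
exact: (galerkin_cvg_op _ _ _ _ sL gA dL C (ltW C0) bC).
Qed.

(** Off the interval [[a, b]], [An - c] expands by [r], whereas [A - c] contracts
    [u] by a smaller factor at each step. *)
Lemma projection_cvg_inner (t : R) u : 0 <= t -> t < r ->
  (forall k, nr ip (iter k (shifted A c) u) <= t ^+ k * nr ip u) ->
  tends_to ip (fun n => Q n u) u.
Proof.
move=> t0 tr hk; have [x Lx xu] := dL u.
pose z n := x n - Q n (x n).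
pose N n : set H := [set w | L n w /\ forall v, G n v -> ip w v = 0].
have GQ n v : G n (Q n v) by have [] := pQ n v.
have zN n : N n (z n).
  split=> [|v Gv]; last by have [_] := pQ n (x n); apply.
  by apply: (subspaceB (sL n)) => //; exact/GL/GQ.
have z0 : tends_to ip z 0.
  move=> e ep.
  apply: (geometric_squeeze ip _ (fun k n => iter k (shifted (An n) c) (x n))
    (fun k => iter k (shifted A c) u) r t (nr ip u)) ep => // [n|k n|k].
  - exact: nr_ge0.
  - rewrite subr0; apply: (component_bound ip (L n) (N n)) => //.
    + by move=> w [].
    + move=> w [Lw ow]; split; first exact: (symmetric_stable _ _ _ (sTn n)).
      move=> v Gv; rewrite (symmetric_ip _ _ _ (sTn n)) //; last exact: GL.
      exact/ow/G_shifted.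
    + exact: le_trans (ltW tr).
    + move=> w [Lw ow]; have [d dLn] := fL n.
      have [m [y [l E]]] := exists_eigen_sum ip _ _ (sL n) (sAn n) w d dLn Lw.
      apply: (eigen_sum_lower_bound ip _ _ (sL n) _ (fun s => s - c)
        _ _ _ _ _ (sTn n) _ E).
      * exact: le_trans (ltW tr).
      * by move=> i; case: E => Ey _ _; rewrite /shifted (Ey i).2 -scalerBl -rmorphB.
      * move=> i; have [lab|y0] := eigen_sum_ortho_galerkin ip _ _ _ _ _ _ _ i ow E;
          last by right.
        left; rewrite real_ler_normr ?num_real //.
        have [la|la] := ltP (l i) a; first by apply/orP; right; lra.
        have [lb|lb] := ltP b (l i); first by apply/orP; left; lra.
        by case: lab; rewrite /= in_itv /= la lb.
    + move=> w [Lw ow]; rewrite /z opprB addrCA subrr addr0.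
      by apply: rip_of_ip0; rewrite ipC ow ?conjc0.
  - by have [] := galerkin_cvg_iter ip _ _ _ k
      (galerkin_cvg_shifted ip _ sL _ _ c An_cvg) _ _ Lx xu.
apply: (tends_to_le ip _ _ _ _ _ _ 2 1 _ _ _ xu z0) => // n.
have h1 : nr ip (Q n (x n - u)) <= nr ip (x n - u) by exact: projection_nr (pQ n) _.
rewrite subr0 mul1r mulr_natl mulr2n.
have -> : Q n u - u = (x n - u) - Q n (x n - u) - z n.
  rewrite (projectionB _ _ _ (pQ n)) /z.
  by rewrite !opprB -addrA subrKA addrC subrKA.
apply: le_trans (nrB _ _ _) _; rewrite lerD2r.
by apply: le_trans (nrB _ _ _) _; rewrite lerD2l.
Qed.

(** On [[a, b]], [K - (An - c)^2] is at least [K - r^2], whereas [K - (A - c)^2]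
    multiplies [u] by a smaller factor at each step. *)
Lemma projection_cvg_outer (K t : R) u : r ^+ 2 <= K -> 0 <= t -> t < K - r ^+ 2 ->
  (forall k, nr ip (iter k (capped A c K) u) <= t ^+ k * nr ip u) ->
  tends_to ip (fun n => Q n u) 0.
Proof.
move=> rK t0 tK hk; have [x Lx xu] := dL u.
have GQ n v : G n (Q n v) by have [] := pQ n v.
pose z n := Q n (x n).
have sBn n : symmetric_on ip (L n) (capped (An n) c K).
  exact: (symmetric_csub_sqr ip _ _ (sL n) (sTn n)).
have z0 : tends_to ip z 0.
  move=> e ep.
  apply: (geometric_squeeze ip _ (fun k n => iter k (capped (An n) c K) (x n))
    (fun k => iter k (capped A c K) u) (K - r ^+ 2) t (nr ip u)) ep => // [n|k n|k].
  - exact: nr_ge0.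
  - rewrite subr0; apply: (component_bound ip (L n) (G n)) => //.
    + move=> w Gw; apply: (subspaceB (Gs n)); first exact: (subspaceZ _ (Gs n)).
      exact/G_shifted/G_shifted.
    + by rewrite subr_ge0.
    + move=> w Gw; have Lw := GL _ _ Gw; have [d dLn] := fL n.
      have [m [y [l E]]] := exists_eigen_sum ip _ _ (sL n) (sAn n) w d dLn Lw.
      apply: (eigen_sum_lower_bound ip _ _ (sL n) _ (fun s => K - (s - c) ^+ 2)
        _ _ _ _ _ (sBn n) _ E).
      * by rewrite subr_ge0.
      * move=> i; case: E => Ey _ _; have [Vy Ty] := Ey i.
        have Sy : shifted (An n) c (y i) = (l i - c)%:C *: y i.
          by rewrite /shifted Ty -scalerBl -rmorphB.
        rewrite /capped Sy (symmetricZ ip _ _ (sL n) (sTn n)) // Sy scalerA.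
        by rewrite -scalerBl -rmorphM -rmorphB expr2.
      * move=> i; have [lab|y0] := eigen_sum_galerkin ip _ _ (sAn n) _ _ _ _ _ i Gw E;
          last by right.
        left; move: lab; rewrite /= in_itv /= => /andP[la lb].
        have h : (l i - c) ^+ 2 <= r ^+ 2.
          rewrite -(real_normK (num_real (l i - c))) ler_pXn2r ?nnegrE //.
            by rewrite ler_norml; apply/andP; split; lra.
          by rewrite divr_ge0 // subr_ge0 ltW.
        rewrite real_ler_normr ?num_real //; apply/orP; left; lra.
    + exact: GQ.
    + move=> w Gw; apply: rip_of_ip0.
      by have [_] := pQ n (x n); apply.
  - by have [] := galerkin_cvg_iter ip _ _ _ k
      (galerkin_cvg_capped ip _ sL _ _ c K An_cvg) _ _ Lx xu.
apply: (tends_to_le ip _ _ _ _ _ _ 1 1 _ _ _ xu z0) => // n.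
have h1 : nr ip (Q n (x n - u)) <= nr ip (x n - u) by exact: projection_nr (pQ n) _.
rewrite !subr0 !mul1r.
have -> : Q n u = z n - Q n (x n - u) by rewrite (projectionB _ _ _ (pQ n)) subKr.
by apply: le_trans (nrB _ _ _) _; rewrite addrC lerD2r.
Qed.

End GalerkinProjection.

(** * Discrete spectrum and form convergence *)

(** A set of reals all of whose points are isolated in [S] is made of its own
    isolated points. *)
Lemma countable_isolated_real (R : realType) (S : set R[i]) (X : set R) :
  (forall x, X x -> isolated (S : set R[i]^o) x%:C) -> countable X.
Proof.
move=> XS; apply: sub_countable (countable_isolated X); apply: subset_card_le.
move=> x Xx; have [xS [V Vx VS]] := XS _ Xx.
split; first exact/mem_set.
move: Vx => /nbhs_ballP [e /= e0 eV].
have eE : e = (complex.Re e)%:C by rewrite RRe_real // gtr0_real.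
exists (ball x (complex.Re e)); first by apply: nbhsx_ballx; rewrite -ltcR -eE.
apply/seteqP; split=> [y [By Xy]|y ->]; last first.
  by split=> //; apply: ballxx; rewrite -ltcR -eE.
have [yS _] := XS _ Xy.
suff : [set x%:C] y%:C by move=> /complexI.
rewrite -VS; split; last exact: set_mem.
apply: eV; rewrite /ball /= eE -rmorphB normc_def /= expr0n addr0 sqrtr_sqr ltcR.
exact: By.
Qed.

Section FormNorm.
Context {R : realType} {H : completeNormedModType R[i]}.
Context (ip : {dot H for (@Num.conj R[i])}).
Hypothesis Hip : hilbert_norm ip.
Variables (A : {linear H -> H}).
Hypothesis (sA : self_adjoint ip A).

(** The shift [m - 1] in the form leaves one copy of [|u|^2] above the lower bound
    [m]. *)
Lemma norm_le_form_norm (m : R) u : m * nr ip u ^+ 2 <= rip ip (A u) u ->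
  (nr ip u)%:C <= form_norm ip A m u.
Proof.
move=> h; have AE : ip (A u) u = (rip ip (A u) u)%:C.
  have := ipC ip (A u) u; rewrite -sA /rip; case: (ip (A u) u) => p q [] q0 /=.
  by congr (_ +i* _); move: q0 => {h} q0; lra.
have fE : form_ip ip A m u u = (rip ip (A u) u - (m - 1) * nr ip u ^+ 2)%:C.
  by rewrite /form_ip /sesqui_form AE ip_self nr_sqr [RHS]rmorphB [in RHS]rmorphM.
have f0 : 0 <= rip ip (A u) u - (m - 1) * nr ip u ^+ 2 - nr ip u ^+ 2 by lra.
rewrite /form_norm fE.
have n0 : 0 <= (nr ip u)%:C by rewrite ler0c nr_ge0.
rewrite -[X in X <= _](sqrCK n0) ler_sqrtC ?nnegrE.
- by rewrite -rmorphXn lecR -subr_ge0.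
- by rewrite -rmorphXn ler0c sqr_ge0.
- by rewrite ler0c (le_trans _ (_ : nr ip u ^+ 2 <= _)) ?sqr_ge0 // -subr_ge0.
Qed.

End FormNorm.
(** * Convergence of the Galerkin spectral projections *)

Theorem lemma2p1 (R : realType) (H : completeNormedModType R[i])
  (ip : {dot H for (@Num.conj R[i])}) (Hip : hilbert_norm ip)
  (A : {linear H -> H}) (A_bounded : bounded_operator A)
  (A_self_adjoint : self_adjoint ip A)
  (m : R) (m_min : is_min_spectrum A m)
  (a b : R) (a_lt_b : a < b)
  (a_resolvent : resolvent_set A a%:C) (b_resolvent : resolvent_set A b%:C)
  (no_essential : forall x : R, x \in `[a, b] -> ~ essential_spectrum A x%:C)
  (E : H -> H)
  (E_proj : orthogonal_projection ip
     (spectral_subspace ip A (real_spectrum A `&` `[a, b])) E)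
  (d : nat) (E_rank : has_dim (range E) d)
  (L : nat -> set H) (L_finite_dim : forall n, finite_dim (L n))
  (L_dense : forall u : H, exists w : nat -> H, (forall n, L n (w n)) /\
     (fun n => form_norm ip A m (u - w n) : R[i]^o) @ \oo --> (0 : R[i]^o))
  (An : nat -> H -> H)
  (An_galerkin : forall n, galerkin_operator ip A (L n) (An n))
  (Q : nat -> H -> H)
  (Q_proj : forall n, orthogonal_projection ip
     (galerkin_subspace (L n) (An n) `[a, b]) (Q n)) :
  forall u : H,
    (fun n => `|Q n u - E u| : R[i]^o) @ \oo --> (0 : R[i]^o).
Proof.
have mA : forall x, x < m -> resolvent_set A x%:C.
  move=> x xm; apply: contrapT => nx; have := (proj2 m_min) x%:C nx.
  by rewrite lecR leNgt xm.
pose D : set R := real_spectrum A `&` `[a, b].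
have cD : countable D.
  apply: (countable_isolated_real _ (spectrum A)) => x [Sx xab].
  have : discrete_spectrum A x%:C.
    by apply: contrapT => nd; apply: (no_essential x xab); split.
  by case.
have mD : measurable (D : set (measurableTypeR R)).
  apply: countable_measurable cD => x; exact: measurable_set1.
have SPE u : exists2 P, spectral_measure ip A P & range (P D) (E u).
  by have [] := E_proj u.
have sL n : subspace (L n).
  by have [dn [x [_ ->]]] := L_finite_dim n; exact: lin_span_subspace.
have dL u : exists2 w : nat -> H, (forall n, L n (w n)) & tends_to ip w u.
  have [w [Lw wu]] := L_dense u; exists w => // e e0.
  have [P SP _] := SPE u.
  move/cvgr0Pnorm_lt: wu => /(_ e%:C); rewrite ltcR => /(_ e0).
  apply: filterS => n; rewrite -ltcR; apply: le_lt_trans.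
  have -> : nr ip (w n - u) = nr ip (u - w n) by rewrite -nrN opprB.
  have h : (nr ip (u - w n))%:C <= form_norm ip A m (u - w n).
    apply: (norm_le_form_norm _ _ A_self_adjoint).
    exact: (spectral_form_ge _ _ A_self_adjoint Hip _ SP).
  rewrite ger0_norm //; apply: le_trans h.
  by rewrite ler0c nr_ge0.
have [C C0 bC] : exists2 C : R, 0 < C &
    forall u, nr ip (shifted A ((a + b) / 2) u) <= C * nr ip u.
  have [C C0 bC] := bounded_nr ip Hip _ A_bounded.
  exists (C + `|(a + b) / 2|) => [|u]; first by rewrite ltr_wpDr.
  apply: le_trans (nrB _ _ _) _; rewrite nrZ [X in _ <= X]mulrDl.
  by apply: lerD.
pose r := (b - a) / 2.
have r0 : 0 < r by rewrite divr_gt0 // subr_gt0.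
move=> u; have [P SP rangeE] := SPE u.
have unch x : resolvent_set A x%:C -> uncharged P x.
  exact: (resolvent_uncharged _ _ A_self_adjoint _ SP Hip).
have [ea ea0 eaP] := uncharged_near _ _ _ SP _ (unch _ a_resolvent).
have [eb eb0 ebP] := uncharged_near _ _ _ SP _ (unch _ b_resolvent).
(* The bound [r / 2] keeps [[a + e, b - e]] nondegenerate. *)
pose e := Num.min (Num.min ea eb) (r / 2).
have e0 : 0 < e by rewrite !lt_min ea0 eb0 divr_gt0.
have er : e < r.
  by apply: (@le_lt_trans _ _ (r / 2)); rewrite ?ge_min ?lexx ?orbT //; lra.
have Pa x : `|x - a| < e -> uncharged P x.
  by move=> h; apply: eaP; apply: lt_le_trans h _; rewrite !ge_min lexx.
have Pb x : `|x - b| < e -> uncharged P x.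
  by move=> h; apply: ebP; apply: lt_le_trans h _; rewrite !ge_min lexx orbT.
have Dab : D `<=` `[a, b] by move=> x [].
have DC x : x \in `[a, b] -> ~ D x -> uncharged P x.
  move=> xab nD; apply: unch; apply: contrapT => nx; apply: nD; split=> //.
have inner : tends_to ip (fun n => Q n (E u)) (E u).
  apply: (projection_cvg_inner ip Hip _ A_self_adjoint _ _ _ _ _ sL L_finite_dim
    An_galerkin dL A_bounded Q_proj (r - e)).
  - by rewrite subr_ge0 ltW.
  - by rewrite gtrBl.
  - apply: (iter_shifted_le ip _ A_self_adjoint P SP a b a_lt_b D mD Dab e e0 er Pa Pb).
    by case: rangeE => v _ <-; apply: (spectral_part_proj _ _ _ SP).
pose K := C ^+ 2 + (r + e) ^+ 2 + 1.
have outer : tends_to ip (fun n => Q n (u - E u)) 0.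
  apply: (projection_cvg_outer ip Hip _ A_self_adjoint _ _ a_lt_b _ _ _ sL L_finite_dim
    An_galerkin dL A_bounded Q_proj K (K - (r + e) ^+ 2)).
  - rewrite /K; have := sqr_ge0 C; have := sqr_ge0 e; have := mulr_gt0 r0 e0.
    by rewrite -/r; lra.
  - by rewrite /K; have := sqr_ge0 C; lra.
  - by rewrite ltrD2l ltrN2 ltr_pXn2r ?nnegrE ?addr_ge0 ?ltW // ltrDl.
  - apply: (iter_capped_le ip _ A_self_adjoint P SP a b a_lt_b D mD DC
      e e0 er Pa Pb C (ltW C0) bC).
    + by rewrite /K; have := sqr_ge0 (r + e); lra.
    + by rewrite -/r /K; have := sqr_ge0 C; lra.
    + have [_ o] := E_proj u.
      have Du : spectral_subspace ip A D (P D (u - E u)).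
        by exists P => //; exists (u - E u).
      apply/eqP; rewrite -(dnorm_eq0 ip).
      rewrite (projection_ip _ _ _ (spectral_measure_proj SP mD)).
      rewrite -(spectral_measureI SP mD mD) setIid; apply/eqP; exact: o.
apply/cvgr0Pnorm_lt => ep ep0.
have epE : ep = (complex.Re ep)%:C by rewrite RRe_real // gtr0_real.
have Rep0 : 0 < complex.Re ep / 2 by rewrite divr_gt0 // -ltcR -epE.
near=> n.
have h1 : nr ip (Q n (E u) - E u) < complex.Re ep / 2 by near: n; exact: inner.
have h2 : nr ip (Q n (u - E u) - 0) < complex.Re ep / 2 by near: n; exact: outer.
rewrite normr_id (normE _ Hip) epE ltcR.
have -> : Q n u - E u = (Q n (E u) - E u) + (Q n (u - E u) - 0).
  by rewrite subr0 (projectionB _ _ _ (Q_proj n)) [RHS]addrC subrKA.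
apply: le_lt_trans (nrD _ _ _) _.
by rewrite [ltRHS]splitr ltrD.
Unshelve. all: by end_near. Qed.
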